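(* Assume $G$ satisfies the Plausibility Assumption and let $D$ be an integer with $1\le D\le\frac13\zeta\cdot\mathrm{SMALL}$. If $p$ is a polynomial in the indeterminates $x_{i,c}$ of degree at most $D$, then $\tilde{\mathbb E}[p^2]\ge0$.
   Context: Fix a finite alphabet $\Omega$ with $|\Omega|=q\ge2$, integers $K\ge3$ and $3\le\tau\le K$. $G$ is a bipartite factor graph between variable-vertices $[n]$ and constraint-vertices; each constraint-vertex $f$ has an ordered neighbourhood $N(f)$ with $\tau-1\le|N(f)|\le K$ and a $(\tau-1)$-wise uniform distribution $\mu_f$ on $\Omega^{N(f)}$ (its marginal on any $\tau-1$ coordinates is uniform). A subgraph is an edge-induced subgraph $H=G[A]$ (possibly empty, not necessarily connected); $\mathrm{vbls}(H),\mathrm{cons}(H)$ are its variable-/constraint-vertices, $N_H(f)$ the variables adjacent to $f$ in $H$. $H$ is a $\tau$-subgraph if $|N_H(f)|\ge\tau$ for all $f\in\mathrm{cons}(H)$; a leaf is a variable-vertex of degree $1$ in $H$. Parameters $1\le\mathrm{SMALL}\le n/2$, $0<\zeta<1$, $K\le\zeta\cdot\mathrm{SMALL}$; $H$ is small if $|\mathrm{cons}(H)|\le\mathrm{SMALL}$. For a $\tau$-subgraph $H$: credits $=$ number of leaves; debits $=\sum_{i}\max(\deg_H(i)-2,0)+\sum_{f}(|N_H(f)|-\tau)$; revenue $R(H)=$ credits $-$ debits; income $I(H)=R(H)-\zeta|\mathrm{cons}(H)|$; plausible means $I(H)\ge0$. Plausibility Assumption: every $\tau$-subgraph with at most $2\cdot\mathrm{SMALL}$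 constraint-vertices is plausible. $H$ is $S$-closed (for a variable set $S$) if it is a $\tau$-subgraph with all leaves in $S$; $\mathrm{cl}(S)$ is the union of all small $S$-closed $\tau$-subgraphs. For a small subgraph $H$, the planted distribution $\eta_H$ on $\Omega^n$: draw independently $w_f\sim\mu_f$ for $f\in\mathrm{cons}(H)$, regard $w_{f,i}$ ($i\in N_H(f)$) as the value suggested for $i$, condition on all suggestions to each $i\in\mathrm{vbls}(H)$ agreeing and let $x_i$ be the common value, and choose $x_i$ for $i\notin\mathrm{vbls}(H)$ independently uniformly. Indeterminates $x_{i,c}$ ($i\in[n],c\in\Omega$); for a polynomial $p$ in them, $\mathrm{vbls}(p)$ is the set of $i$ with some $x_{i,c}$ appearing in $p$, $\deg_{\mathrm{mlin}}(p)=\max|\mathrm{vbls}(M)|$ over monomials $M$ of $p$, and for $x\in\Omega^n$, $p(x)$ denotes evaluation at $x_{i,c}=\mathbf 1[x_i=c]$. $\tilde{\mathbb E}$ is the linear functional on polynomials of multilinear degree at most $\zeta\cdot\mathrm{SMALL}$ defined on monomials by $\tilde{\mathbb E}[M]=\mathbb E_{x\sim\eta_{\mathrm{cl}(\mathrm{vbls}(M))}}[M(x)]$ (these closures are small under the Plausibility Assumption). *)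

(* Defs.v *)
From HB Require Import structures.
From mathcomp Require Import all_boot all_order all_algebra.
From mathcomp Require Export mpoly.

Set Implicit Arguments.
Unset Strict Implicit.
Unset Printing Implicit Defensive.

Import Order.TTheory GRing.Theory Num.Theory.
Local Open Scope ring_scope.

(* Factor graph with variable-vertices 'I_n and constraint-vertices F.  The   *)
(* scope of f lists N(f) in order, so that Omega^N(f) is identified with      *)
(* (arity f).-tuple Omega, position j holding the value of tnth (scope f) j.  *)
Record factor_graph (R : realFieldType) (Omega F : finType) (n : nat) :=
  FactorGraph {
    arity : F -> nat;
    scope : forall f : F, (arity f).-tuple 'I_n;
    scope_uniq : forall f : F, uniq (scope f);
    mu : forall f : F, (arity f).-tuple Omega -> R;
    mu_ge0 : forall (f : F) (w : (arity f).-tuple Omega), 0 <= mu w;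
    mu_sum1 : forall f : F, \sum_(w : (arity f).-tuple Omega) mu w = 1 }.

Definition wise_uniform (R : realFieldType) (Omega : finType) (k t : nat)
    (nu : k.-tuple Omega -> R) : Prop :=
  forall (S : {set 'I_k}) (y : k.-tuple Omega), #|S| = t ->
    \sum_(w : k.-tuple Omega | [forall j in S, tnth w j == tnth y j]) nu w
      = (#|Omega| ^ t)%:R^-1.

Section EdgeSets.

Variables (F : finType) (n : nat).
(* The edge-induced subgraph G[A] is represented by its edge set A; the edge  *)
(* between f and i is the pair (f, i).                                        *)
Implicit Types (A : {set F * 'I_n}) (f : F) (i : 'I_n).

Definition cons_of A : {set F} := [set e.1 | e in A].
Definition vbls_of A : {set 'I_n} := [set e.2 | e in A].
Definition nbrs A f : {set 'I_n} := [set i | (f, i) \in A].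
Definition vdeg A i : nat := #|[set f | (f, i) \in A]|.
Definition leaves A : {set 'I_n} := [set i | vdeg A i == 1%N].

Definition credits A : int := #|leaves A|%:Z.

Definition debits (tau : nat) A : int :=
  \sum_(i in vbls_of A) Num.max ((vdeg A i)%:Z - 2) 0
  + \sum_(f in cons_of A) (#|nbrs A f|%:Z - tau%:Z).

Definition revenue (tau : nat) A : int := credits A - debits tau A.

Definition income (R : realFieldType) (tau : nat) (zeta : R) A : R :=
  (revenue tau A)%:~R - zeta * #|cons_of A|%:R.

Definition plausible (R : realFieldType) (tau : nat) (zeta : R) A : bool :=
  0 <= income tau zeta A.

Definition small (R : realFieldType) (SMALL : R) A : bool :=
  #|cons_of A|%:R <= SMALL.

End EdgeSets.

Section FactorGraph.

Variables (R : realFieldType) (Omega F : finType) (n : nat).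
Variable G : factor_graph R Omega F n.
Implicit Types (A : {set F * 'I_n}) (S : {set 'I_n}).

Definition edges : {set F * 'I_n} := [set e | e.2 \in scope G e.1].

Definition tau_subgraph (tau : nat) A : bool :=
  (A \subset edges) && [forall f in cons_of A, (tau <= #|nbrs A f|)%N].

Definition plausibility_assumption (tau : nat) (SMALL zeta : R) : Prop :=
  forall A, tau_subgraph tau A -> #|cons_of A|%:R <= 2 * SMALL ->
    plausible tau zeta A.

Definition closed_for (tau : nat) S A : bool :=
  tau_subgraph tau A && (leaves A \subset S).

Definition closure_of (tau : nat) (SMALL : R) S : {set F * 'I_n} :=
  \bigcup_(A | closed_for tau S A && small SMALL A) A.

(* A choice of w_f in Omega^N(f) for every f in cons(A).                      *)
Definition draws A :=
  fprod (fun f : {f : F | f \in cons_of A} => (arity G (val f)).-tuple Omega).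

Definition draws_prob A (w : draws A) : R :=
  \prod_(f : {f : F | f \in cons_of A}) mu (w f).

(* The suggestion w_f,i, for i = tnth (scope G f) j, is tnth (w f) j; only    *)
(* the positions j whose edge (f, i) is in A make a suggestion.               *)
Definition draws_agree A (w : draws A) : bool :=
  [forall f : {f : F | f \in cons_of A}, forall j : 'I_(arity G (val f)),
   forall f' : {f : F | f \in cons_of A}, forall j' : 'I_(arity G (val f')),
    [&& (val f, tnth (scope G (val f)) j) \in A,
        (val f', tnth (scope G (val f')) j') \in A
      & tnth (scope G (val f)) j == tnth (scope G (val f')) j']
    ==> (tnth (w f) j == tnth (w f') j')].

Definition draws_match A (w : draws A) (x : {ffun 'I_n -> Omega}) : bool :=
  [forall f : {f : F | f \in cons_of A}, forall j : 'I_(arity G (val f)),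
    ((val f, tnth (scope G (val f)) j) \in A)
    ==> (x (tnth (scope G (val f)) j) == tnth (w f) j)].

Definition agree_prob A : R :=
  \sum_(w : draws A | draws_agree w) draws_prob w.

(* Conditional probability, given agreement, that the common suggestions are  *)
(* the values of x on vbls(A), times the probability of the independent       *)
(* uniform choices outside vbls(A).                                           *)
Definition planted A (x : {ffun 'I_n -> Omega}) : R :=
  (\sum_(w : draws A | draws_agree w && draws_match w x) draws_prob w)
    / agree_prob A
  * \prod_(i | i \notin vbls_of A) #|Omega|%:R^-1.

Definition planted_expectation A (g : {ffun 'I_n -> Omega} -> R) : R :=
  \sum_(x : {ffun 'I_n -> Omega}) planted A x * g x.

(* The indeterminate x_(i,c) is 'X_(enum_rank (i, c)).                        *)
Definition indet_count := #|{: 'I_n * Omega}|.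

Definition indicator_point (x : {ffun 'I_n -> Omega}) (v : 'I_indet_count) : R :=
  (x (enum_val v).1 == (enum_val v).2)%:R.

Definition mnm_vbls (m : 'X_{1..indet_count}) : {set 'I_n} :=
  [set (enum_val v).1 | v : 'I_indet_count & m v != 0%N].

Definition pseudo_expectation_mnm (tau : nat) (SMALL : R)
    (m : 'X_{1..indet_count}) : R :=
  planted_expectation (closure_of tau SMALL (mnm_vbls m))
    (fun x => ('X_[m] : {mpoly R[indet_count]}).@[indicator_point x]).

(* Linear extension from monomials.  The formula makes sense for every p, but *)
(* it is meaningful only when every monomial m of p satisfies                 *)
(* #|mnm_vbls m| <= zeta * SMALL, which guarantees that the closures used are *)
(* small and the planted distributions well defined.                          *)
Definition pseudo_expectation (tau : nat) (SMALL : R)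
    (p : {mpoly R[indet_count]}) : R :=
  \sum_(m <- msupp p) p@_m * pseudo_expectation_mnm tau SMALL m.

End FactorGraph.

Arguments mu {R Omega F n} _ [f] _ : rename.

(* Main.v *)
Require Import Defs.
From HB Require Import structures.
From mathcomp Require Import all_boot all_order all_algebra.
From mathcomp Require Import zify ring.

Set Implicit Arguments.
Unset Strict Implicit.
Unset Printing Implicit Defensive.

Import Order.TTheory GRing.Theory Num.Theory.
Local Open Scope ring_scope.

(** Expand the density of every planted distribution with respect to the
    uniform one into components chi_B, one for each edge set B: chi_B vanishes
    unless B is a tau-subgraph, because the constraints are (tau - 1)-wise
    uniform, and it has mean zero in every variable that is a leaf of B.  Hence
    the pseudo-expectation of a function of few variables is its integral
    against one fixed signed density Phi, the sum of chi_B over all small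
    tau-subgraphs B, and Phi may be replaced by the nonnegative density of any
    small edge set that contains the closure of the variables involved.

    Positivity is shown by adding the functions of S one set S at a time, in
    order of increasing size, keeping the form (u, v) |-> E[u v Phi] positive
    semidefinite.  Let C be a largest small set of constraints whose completion
    around S costs nothing, that is 2 |N(C) \ S| <= sum over f in C of
    (2 |N(f)| - tau), and let X be the union of S and N(C).  A function g of S
    is projected, with respect to the density of C, onto the functions of
    smaller sets inside X.  The remainder is orthogonal to every earlier
    function t of a set T: conditioning on X turns t chi_B into a function of
    the part of X that meets T or B, and by the maximality of C a count of the
    edges of B shows that this part has fewer than |T| elements when B is not
    empty. *)

(** * Moebius inversion and averaging *)

Section Moebius.

Variables (R : comNzRingType) (T : finType).
Implicit Types (A B : {set T}) (u : {set T} -> R).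

Definition moebius u B : R := \sum_(A : {set T} | A \subset B) (-1) ^+ #|B :\: A| * u A.

Lemma big_subsetU1 (V : nmodType) (e : T) B (G : {set T} -> V) : e \notin B ->
  \sum_(A : {set T} | A \subset e |: B) G A =
  \sum_(A : {set T} | A \subset B) G (e |: A) + \sum_(A : {set T} | A \subset B) G A.
Proof.
move=> eB; rewrite (bigID (fun A : {set T} => e \in A)) /=; congr (_ + _); last first.
  apply: eq_bigl => A; apply/andP/idP => [[sA eA]|sA].
    apply/subsetP => z zA; have := subsetP sA z zA.
    by rewrite !inE => /orP[/eqP ez|//]; rewrite -ez zA in eA.
  split; first exact: subset_trans sA (subsetU1 _ _).
  by apply: contra eB => /(subsetP sA).
rewrite (reindex_onto (fun A => e |: A) (fun A => A :\ e)) /=; last first.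
  by move=> A /andP[_ eA]; rewrite setD1K.
apply: eq_bigl => A; rewrite setU11 andbT; apply/andP/idP => [[sA /eqP eA]|sA].
  apply/subsetP => z zA; have zA' : z \in e |: A by rewrite inE zA orbT.
  have := subsetP sA z zA'; rewrite !inE => /orP[/eqP ez|//].
  by move: zA; rewrite -eA ez !inE eqxx.
by rewrite setUS // setU1K //; apply: contra eB => /(subsetP sA).
Qed.

Lemma moebiusU1 u e B : e \notin B ->
  moebius u (e |: B) = moebius (fun A => u (e |: A)) B - moebius u B.
Proof.
move=> eB; rewrite /moebius big_subsetU1 // -sumrN; congr (_ + _).
  apply: eq_bigr => A sA; congr ((-1) ^+ #|pred_of_set _| * _); apply/setP => z.
  rewrite !inE; case: (eqVneq z e) => [->|//]; rewrite (negPf eB) /= andbF //.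
apply: eq_bigr => A sA; have -> : (e |: B) :\: A = e |: (B :\: A).
  apply/setP => z; rewrite !inE; case: (eqVneq z e) => [->|//] /=.
  by rewrite (contra (subsetP sA e)).
by rewrite cardsU1 !inE (negPf eB) andbF /= exprS mulN1r mulNr.
Qed.

(** Induction on the size of [A]: pairing [B] with [e |: B] cancels [moebius u B] and leaves the
    claim on [A :\ e] for the function sending [A] to [u (e |: A)]. *)
Lemma moebius_inv u A : \sum_(B : {set T} | B \subset A) moebius u B = u A.
Proof.
have [k] := ubnP #|A|; elim: k u A => // k IH u A leA.
have [->|[e eA]] := set_0Vmem A.
  rewrite (big_pred1 set0) => [|B]; last by rewrite subset0.
  rewrite /moebius (big_pred1 set0) => [|B]; last by rewrite subset0.
  by rewrite setD0 cards0 mul1r.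
have eA' : e \notin A :\ e by rewrite !inE eqxx.
rewrite -{1}(setD1K eA) big_subsetU1 // -big_split /=.
under eq_bigr => B sB.
  rewrite moebiusU1 ?subrK; last by apply: contra eA' => /(subsetP sB).
  over.
rewrite IH; first by rewrite setD1K.
by rewrite (cardsD1 e) eA in leA.
Qed.

(** Toggling [e] leaves [u] unchanged, so the two sums in [moebiusU1] cancel. Both vanishing
    properties of the components [chi] come from this. *)
Lemma moebius_eq0 u e B : e \in B ->
  (forall A, A \subset B -> e \in A -> u A = u (A :\ e)) -> moebius u B = 0.
Proof.
move=> eB uB; rewrite -(setD1K eB) moebiusU1 ?inE ?eqxx //.
apply/eqP; rewrite subr_eq0; apply/eqP/eq_bigr => A sA; congr (_ * _).
have eA : e \notin A by apply/negP => /(subsetP sA); rewrite !inE eqxx.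
rewrite uB ?setU11 ?setU1K // subUset sub1set eB.
exact: subset_trans sA (subsetDl _ _).
Qed.

End Moebius.

(** * Functions of few coordinates and averaging over the others *)

Section Points.

Variables (R : realFieldType) (Omega : finType) (n : nat).
Local Notation point := {ffun 'I_n -> Omega}.
Implicit Types (x y : point) (U V : {set 'I_n}) (i : 'I_n).

Definition depends_on (S : Type) U (u : point -> S) : Prop :=
  forall x y, {in U, x =1 y} -> u x = u y.

Definition mix U x y : point := [ffun i => if i \in U then x i else y i].
Definition upd x i (c : Omega) : point := [ffun j => if j == i then c else x j].

Lemma depends_onS (S : Type) U V (u : point -> S) :
  U \subset V -> depends_on U u -> depends_on V u.
Proof. by move=> sUV uU x y xy; apply: uU => i /(subsetP sUV)/xy. Qed.

Lemma depends_onM U V (u v : point -> R) :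
  depends_on U u -> depends_on V v -> depends_on (U :|: V) (fun x => u x * v x).
Proof.
move=> uU vV x y xy; rewrite (uU x y) 1?(vV x y) //.
  by move=> i iV; apply: xy; rewrite inE iV orbT.
by move=> i iV; apply: xy; rewrite inE iV.
Qed.

(** Exchanging the coordinates outside [U] between two points is an involution on pairs. *)
Lemma sum_mix U (F : point -> point -> R) :
  \sum_x \sum_y F (mix U x y) (mix U y x) = \sum_x \sum_y F x y.
Proof.
rewrite !pair_bigA /=.
rewrite [RHS](reindex_inj (h := fun p => (mix U p.1 p.2, mix U p.2 p.1))) //.
apply: (can_inj (g := fun p => (mix U p.1 p.2, mix U p.2 p.1))) => -[x y] /=.
by congr (_, _); apply/ffunP => i; rewrite !ffunE; case: (i \in U).
Qed.

Lemma sum_upd i (u : point -> R) :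
  \sum_x \sum_c u (upd x i c) = #|Omega|%:R * \sum_x u x.
Proof.
rewrite pair_bigA /=.
have h_inj : injective (fun p : point * Omega => (upd p.1 i p.2, p.1 i)).
  apply: (can_inj (g := fun p => (upd p.1 i p.2, p.1 i))) => -[x c] /=.
  congr (_, _); last by rewrite ffunE eqxx.
  by apply/ffunP => j; rewrite !ffunE; case: eqVneq => [->|].
transitivity (\sum_(p : point * Omega) u p.1); first by rewrite [RHS](reindex_inj h_inj).
rewrite -(pair_bigA _ (fun x _ => u x)) /= mulr_sumr.
by apply: eq_bigr => x _; rewrite sumr_const mulr_natl.
Qed.

Lemma upd_id U x i c : i \notin U -> {in U, upd x i c =1 x}.
Proof. by move=> iU j jU; rewrite ffunE; case: eqVneq jU iU => [-> ->|]. Qed.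

Lemma depends_on_upd (S : Type) U (u : point -> S) x i c :
  depends_on U u -> i \notin U -> u (upd x i c) = u x.
Proof. by move=> uU iU; apply: uU; apply: upd_id. Qed.

Definition mean0 i (u : point -> R) : Prop := forall x, \sum_c u (upd x i c) = 0.

Lemma mean0_sum i (u : point -> R) : (0 < #|Omega|)%N -> mean0 i u -> \sum_x u x = 0.
Proof.
move=> q_gt0 ui; have := sum_upd i u; rewrite big1 // => /esym/eqP.
by rewrite mulf_eq0 pnatr_eq0 eqn0Ngt q_gt0 => /eqP.
Qed.

(* Not normalised: #|Omega| ^ n times the conditional expectation given U.    *)
Definition avg U (u : point -> R) x : R := \sum_y u (mix U x y).

Lemma mean0M U i (u v : point -> R) : depends_on U v -> i \notin U ->
  mean0 i u -> mean0 i (fun x => v x * u x).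
Proof.
move=> vU iU ui x; under eq_bigr do rewrite (depends_on_upd _ _ vU iU).
by rewrite -mulr_sumr ui mulr0.
Qed.

Lemma avg_depends U V (u : point -> R) : depends_on V u ->
  depends_on (U :&: V) (avg U u).
Proof.
move=> uV x y xy; apply: eq_bigr => z _; apply: uV => i iV; rewrite !ffunE.
by case: ifP => // iU; apply: xy; rewrite inE iU.
Qed.

(** Since [k] sees only [U], it takes the same value at [x] and at [mix U x y]; [sum_mix] then
    undoes the mixing. *)
Lemma sum_avg U (k u : point -> R) : depends_on U k ->
  \sum_x k x * avg U u x = #|{: point}|%:R * \sum_x k x * u x.
Proof.
move=> kU.
transitivity (\sum_(x : point) \sum_(y : point) k x * u x).
  rewrite -[RHS](sum_mix U); apply: eq_bigr => x _; rewrite mulr_sumr.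
  apply: eq_bigr => y _; congr (_ * _); apply: kU => i iU.
  by rewrite ffunE iU.
by rewrite mulr_sumr; apply: eq_bigr => x _; rewrite sumr_const mulr_natl.
Qed.

End Points.

(** * Densities and their components *)

Section EdgeSetLemmas.

Variables (F : finType) (n : nat).
Implicit Types (A B : {set F * 'I_n}) (f : F) (i : 'I_n) (C : {set F}).

Lemma mem_cons_of A f : (f \in cons_of A) = (nbrs A f != set0).
Proof.
apply/imsetP/set0Pn => [[[f' i] eA /= ->]|[i]]; first by exists i; rewrite inE.
by rewrite inE => eA; exists (f, i).
Qed.

Lemma mem_vbls_of A i : (i \in vbls_of A) = (0 < vdeg A i)%N.
Proof.
rewrite /vdeg card_gt0; apply/imsetP/set0Pn => [[[f i'] eA /= ->]|[f]].
  by exists f; rewrite inE.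
by rewrite inE => eA; exists (f, i).
Qed.

Lemma cons_ofS A B : A \subset B -> cons_of A \subset cons_of B.
Proof. exact: imsetS. Qed.

Lemma vbls_ofS A B : A \subset B -> vbls_of A \subset vbls_of B.
Proof. exact: imsetS. Qed.

Lemma nbrsS A B f : A \subset B -> nbrs A f \subset nbrs B f.
Proof. by move=> sAB; apply/subsetP => i; rewrite !inE => /(subsetP sAB). Qed.

Lemma vdegS A B i : A \subset B -> (vdeg A i <= vdeg B i)%N.
Proof.
by move=> sAB; apply/subset_leq_card/subsetP => f; rewrite !inE => /(subsetP sAB).
Qed.

Lemma nbrs_sub_vbls A f : nbrs A f \subset vbls_of A.
Proof. by apply/subsetP => i; rewrite inE => eA; apply/imsetP; exists (f, i). Qed.

Lemma cons_of0 : cons_of (set0 : {set F * 'I_n}) = set0.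
Proof. exact: imset0. Qed.

Lemma cons_of_eq0 A : (cons_of A == set0) = (A == set0).
Proof. exact: imset_eq0. Qed.

Lemma cons_ofU A B : cons_of (A :|: B) = cons_of A :|: cons_of B.
Proof. exact: imsetU. Qed.

Lemma nbrsU A B f : nbrs (A :|: B) f = nbrs A f :|: nbrs B f.
Proof. by apply/setP => i; rewrite !inE. Qed.

Lemma leaves0 : leaves (set0 : {set F * 'I_n}) = set0.
Proof.
apply/setP => i; rewrite in_set0; apply/negbTE.
have : i \notin vbls_of (set0 : {set F * 'I_n}) by rewrite /vbls_of imset0 inE.
by rewrite inE mem_vbls_of -eqn0Ngt => /eqP->.
Qed.

Lemma leavesU A B : leaves (A :|: B) \subset leaves A :|: leaves B.
Proof.
apply/subsetP => i; rewrite !inE => /eqP dAB.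
have : i \in vbls_of (A :|: B) by rewrite mem_vbls_of dAB.
rewrite /vbls_of imsetU -/(vbls_of A) -/(vbls_of B) inE !mem_vbls_of.
have := vdegS i (subsetUl A B); have := vdegS i (subsetUr A B); rewrite dAB.
by case: (vdeg A i) => [|[|?]]; case: (vdeg B i) => [|[|?]].
Qed.

Lemma leaf_edge A i : i \in leaves A ->
  exists f, (f, i) \in A /\ forall g, (g, i) \in A -> g = f.
Proof.
rewrite inE => /cards1P[f Af]; exists f; split=> [|g gA].
  by have : f \in [set f] by [rewrite inE]; rewrite -Af inE.
by apply/set1P; rewrite -Af inE.
Qed.

Definition restrict C A : {set F * 'I_n} := [set e in A | e.1 \in C].

Lemma restrict_sub C A : restrict C A \subset A.
Proof. by apply/subsetP => e; rewrite inE => /andP[]. Qed.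

Lemma nbrs_restrict C A f : nbrs (restrict C A) f = if f \in C then nbrs A f else set0.
Proof. by apply/setP => i; case: ifP => fC; rewrite !inE /= fC ?andbT ?andbF. Qed.

Lemma cons_of_restrict C A : cons_of (restrict C A) = cons_of A :&: C.
Proof.
apply/setP => f; rewrite inE !mem_cons_of nbrs_restrict.
by case: ifP; rewrite ?andbT ?andbF ?eqxx.
Qed.

End EdgeSetLemmas.

Section Densities.

Variables (R : realFieldType) (Omega F : finType) (n : nat).
Variable G : factor_graph R Omega F n.
Hypothesis q_gt0 : (0 < #|Omega|)%N.
Local Notation point := {ffun 'I_n -> Omega}.
Local Notation q := (#|Omega|%:R : R).
Implicit Types (A B : {set F * 'I_n}) (N : {set 'I_n}) (f : F) (x : point) (C : {set F}).

Let q_neq0 : q != 0. Proof. by rewrite pnatr_eq0 -lt0n. Qed.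

Definition compat f N x (w : (arity G f).-tuple Omega) : bool :=
  [forall j : 'I_(arity G f),
    (tnth (scope G f) j \in N) ==> (x (tnth (scope G f) j) == tnth w j)].

Definition marg f N x : R := \sum_(w : (arity G f).-tuple Omega | compat N x w) mu G w.

Lemma marg_ge0 f N x : 0 <= marg f N x.
Proof. by apply: sumr_ge0 => w _; apply: mu_ge0. Qed.

Lemma marg_depends f N : depends_on N (marg f N).
Proof.
move=> x y xy; apply: eq_bigl => w; apply: eq_forallb => j.
by case: (boolP (_ \in N)) => //= jN; rewrite xy.
Qed.

Lemma marg0 f x : marg f set0 x = 1.
Proof.
rewrite -[RHS](mu_sum1 G f); apply: eq_bigl => w.
by apply/forallP => j; rewrite inE.
Qed.

(** A draw [w] compatible off [i] is compatible with exactly one value [c], its entry at the only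
    position of [i] in the scope. *)
Lemma sum_marg f N x i : i \in scope G f -> i \in N ->
  \sum_c marg f N (upd x i c) = marg f (N :\ i) x.
Proof.
move=> /tnthP[j0 ij0] iN.
have cE c w : compat N (upd x i c) w = compat (N :\ i) x w && (c == tnth w j0).
  apply/forallP/andP => [h|[/forallP h /eqP ce] j].
    split; last by have := h j0; rewrite -ij0 iN ffunE eqxx.
    apply/forallP => j; apply/implyP; rewrite !inE => /andP[ji jN].
    by have := h j; rewrite jN ffunE (negPf ji).
  apply/implyP => jN; rewrite ffunE; case: (eqVneq (tnth (scope G f) j) i) => ji.
    have inj : injective (tnth (scope G f)) by apply/tuple_uniqP/scope_uniq.
    by rewrite ce -(inj j j0) // ji.
  by have := h j; rewrite !inE ji jN.
rewrite /marg (exchange_big_dep (compat (N :\ i) x)) /=; last first.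
  by move=> c w _; rewrite cE => /andP[].
apply: eq_bigr => w cw; rewrite (big_pred1 (tnth w j0)) // => c.
by rewrite cE cw.
Qed.

(** For [t] variables this is the hypothesis; a smaller [N] is enlarged by a further variable of the
    scope, whose value is then summed out. *)
Lemma marg_uniform t f N x : wise_uniform t (@mu R Omega F n G f) ->
  (t <= arity G f)%N -> N \subset scope G f -> (#|N| <= t)%N ->
  marg f N x = q ^- #|N|.
Proof.
move=> uf tf; have [k] := ubnP (t - #|N|)%N.
elim: k N x => // k IH N x ltk sN leN.
have card_scope : #|scope G f| = arity G f.
  by rewrite (card_uniqP (scope_uniq G f)) size_tuple.
move: (leN); rewrite leq_eqVlt => /orP[/eqP eN|ltN].
  pose S : {set 'I_(arity G f)} := [set j | tnth (scope G f) j \in N].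
  have inj : injective (tnth (scope G f)) by apply/tuple_uniqP/scope_uniq.
  have cS : #|S| = t.
    rewrite -eN -(card_imset _ inj); apply: eq_card => i.
    apply/imsetP/idP => [[j]|iN]; first by rewrite inE => jN ->.
    by have /tnthP[j ij] := subsetP sN i iN; exists j; rewrite // inE -ij.
  rewrite eN -natrX -(uf S [tuple x (tnth (scope G f) j) | j < arity G f] cS).
  apply: eq_bigl => w; apply: eq_forallb => j.
  by rewrite inE tnth_mktuple eq_sym.
have [i iN iS] : exists2 i, i \notin N & i \in scope G f.
  apply/exists_inP; rewrite -[X in is_true X]negbK negb_exists_in.
  apply/negP => /forall_inP h; move: (leq_trans ltN tf); rewrite -card_scope ltnNge.
  case/negP; apply/subset_leq_card/subsetP => i iS.
  by case: (boolP (i \in N)) => // /h; rewrite iS.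
have := sum_marg x iS (setU11 i N); rewrite setU1K // => <-.
under eq_bigr => c _.
  rewrite IH.
  - over.
  - by rewrite cardsU1 iN add1n subnS prednK ?subn_gt0 // -ltnS.
  - by apply/subsetP => z; rewrite !inE => /orP[/eqP ->//|/(subsetP sN)].
  - by rewrite cardsU1 iN.
by rewrite sumr_const cardsU1 iN add1n exprS invfM -[LHS]mulr_natl mulrA divff // mul1r.
Qed.

(** Up to a constant, the density of the planted distribution of [A] relative to the uniform one.
    The powers of [q] make the factor of a constraint with uniform marginal equal to 1. *)
Definition dens A x : R := \prod_f (q ^+ #|nbrs A f| * marg f (nbrs A f) x).

Lemma dens_ge0 A x : 0 <= dens A x.
Proof. by apply: prodr_ge0 => f _; rewrite mulr_ge0 ?marg_ge0 ?exprn_ge0 ?ler0n. Qed.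

Lemma dens_depends A : depends_on (vbls_of A) (dens A).
Proof.
move=> x y xy; apply: eq_bigr => f _; congr (_ * _); apply: marg_depends => i.
by move=> /(subsetP (nbrs_sub_vbls A f))/xy.
Qed.

Lemma dens_set0 x : dens set0 x = 1.
Proof.
apply: big1 => f _; have -> : nbrs (set0 : {set F * 'I_n}) f = set0.
  by apply/setP => i; rewrite !inE.
by rewrite cards0 marg0 mulr1.
Qed.

Lemma dens_restrict C A x :
  dens A x = dens (restrict C A) x * dens (restrict (~: C) A) x.
Proof.
rewrite -big_split /=; apply: eq_bigr => f _; rewrite !nbrs_restrict inE.
by case: (f \in C); rewrite /= cards0 marg0 !mulr1 ?mul1r.
Qed.

Lemma nbrs_edges A f : A \subset edges G -> nbrs A f \subset scope G f.
Proof. by move=> sA; apply/subsetP => i; rewrite inE => /(subsetP sA); rewrite inE. Qed.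

Lemma nbrsD1 A f i : nbrs (A :\ (f, i)) f = nbrs A f :\ i.
Proof. by apply/setP => j; rewrite !inE xpair_eqE eqxx. Qed.

Lemma nbrsD1_neq A f g i : g != f -> nbrs (A :\ (f, i)) g = nbrs A g.
Proof. by move=> gf; apply/setP => j; rewrite !inE xpair_eqE (negPf gf). Qed.

Lemma dens_uniform t A f i x : wise_uniform t (@mu R Omega F n G f) ->
  (t <= arity G f)%N -> A \subset edges G -> (#|nbrs A f| <= t)%N ->
  dens A x = dens (A :\ (f, i)) x.
Proof.
move=> uf tf sA leA; rewrite /dens (bigD1 f) //= [RHS](bigD1 f) //=.
congr (_ * _); last by apply: eq_bigr => g gf; rewrite nbrsD1_neq.
have sN := nbrs_edges f sA.
have sNi : nbrs A f :\ i \subset scope G f by apply: subset_trans (subsetDl _ _) sN.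
rewrite nbrsD1 !(marg_uniform _ uf) // ?divff ?expf_neq0 //.
by apply: leq_trans leA; apply/subset_leq_card/subsetDl.
Qed.

(** Only the factor of [f] involves the leaf [i]. Summing out its value removes [i] from the
    marginal and leaves over one of the powers of [q]. *)
Lemma dens_leaf A f i x : A \subset edges G -> (f, i) \in A ->
  (forall g, (g, i) \in A -> g = f) ->
  \sum_c dens A (upd x i c) = q * dens (A :\ (f, i)) x.
Proof.
move=> sA eA iA; rewrite /dens [in RHS](bigD1 f) //= nbrsD1.
have iN : i \in nbrs A f by rewrite inE.
have iS : i \in scope G f by have := subsetP sA _ eA; rewrite inE.
under eq_bigr => c _.
  rewrite (bigD1 f) //=.
  under [X in _ * X]eq_bigr => g gf.
    rewrite (depends_on_upd _ _ (@marg_depends g _)); last first.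
      by rewrite inE; apply: contra gf => /iA/eqP.
    over.
  over.
rewrite -mulr_suml -mulr_sumr sum_marg // (cardsD1 i (nbrs A f)) iN exprS -!mulrA.
congr (_ * (_ * (_ * _))).
by apply: eq_bigr => g gf; rewrite nbrsD1_neq.
Qed.

Definition chi B x : R := moebius (fun A => dens A x) B.

Lemma sum_chi A x : \sum_(B : {set F * 'I_n} | B \subset A) chi B x = dens A x.
Proof. exact: moebius_inv. Qed.

Lemma chi_depends B : depends_on (vbls_of B) (chi B).
Proof.
move=> x y xy; apply: eq_bigr => A sA; congr (_ * _); apply: dens_depends => i.
by move=> /(subsetP (vbls_ofS sA))/xy.
Qed.

(** Some [f] has between 1 and [tau - 1] edges in [B]. By uniformity, removing such an edge from any
    subset of [B] does not change its density. *)
Lemma chi_tau tau B x : (forall f, (tau.-1 <= arity G f)%N) ->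
  (forall f, wise_uniform tau.-1 (@mu R Omega F n G f)) ->
  B \subset edges G -> ~~ tau_subgraph G tau B -> chi B x = 0.
Proof.
move=> tauG uG sB; rewrite /tau_subgraph sB /= => /forall_inPn[f].
rewrite mem_cons_of -ltnNge => /set0Pn[i]; rewrite inE => eB ltf.
apply: (moebius_eq0 eB) => A sA eA; apply: dens_uniform (uG f) (tauG f) _ _.
  exact: subset_trans sB.
apply: leq_trans (subset_leq_card (nbrsS f sA)) _.
by case: tau ltf {uG tauG}.
Qed.

(** Once the value at [i] is summed out, the density of a subset of [B] no longer shows whether the
    subset contains the edge at [i]. *)
Lemma chi_mean0 B i : B \subset edges G -> i \in leaves B -> mean0 i (chi B).
Proof.
move=> sB /leaf_edge[f [eB fB]] x.
have -> : \sum_c chi B (upd x i c) = moebius (fun A => \sum_c dens A (upd x i c)) B.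
  by rewrite exchange_big /=; apply: eq_bigr => A _; rewrite mulr_sumr.
apply: (moebius_eq0 eB) => A sA eA; rewrite (@dens_leaf A f) //; last first.
- by move=> g /(subsetP sA); apply: fB.
- exact: subset_trans sB.
under eq_bigr => c _.
  rewrite (depends_on_upd _ _ (@dens_depends _)); last first.
    apply/imsetP => -[[g j]]; rewrite !inE xpair_eqE => /andP[+ /(subsetP sA) gB] /= ij.
    by rewrite -ij in gB *; rewrite (fB g gB) !eqxx.
  over.
by rewrite sumr_const mulr_natl.
Qed.

End Densities.

Lemma Posz_sum (I : Type) (r : seq I) (P : pred I) (h : I -> nat) :
  (\sum_(i <- r | P i) h i)%N%:Z = \sum_(i <- r | P i) (h i)%:Z.
Proof. exact: (big_morph Posz PoszD (erefl _)). Qed.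

(** * Double counting of edges and a closed form of the revenue *)

Section EdgeCounts.

Variables (F : finType) (n : nat).
Implicit Types (A : {set F * 'I_n}).

Lemma sum_nbrs A : (\sum_f #|nbrs A f| = #|A|)%N.
Proof.
rewrite -sum1_card (eq_bigl (fun e => (e.1, e.2) \in A)) => [|[]//].
rewrite -(pair_big_dep predT (fun f i => (f, i) \in A) (fun _ _ => 1%N)) /=.
by apply: eq_bigr => f _; rewrite -sum1_card; apply: eq_bigl => i; rewrite inE.
Qed.

Lemma sum_vdeg A : (\sum_i vdeg A i = #|A|)%N.
Proof.
rewrite -sum_nbrs; under eq_bigr do rewrite /vdeg -sum1_card.
under [RHS]eq_bigr do rewrite -sum1_card.
rewrite (exchange_big_dep predT) //=; apply: eq_bigr => f _.
by apply: eq_bigl => i; rewrite !inE.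
Qed.

Lemma sum_cons_nbrs A : (\sum_(f in cons_of A) #|nbrs A f| = #|A|)%N.
Proof.
rewrite -sum_nbrs [RHS](bigID [in cons_of A]) /= [X in (_ + X)%N]big1 ?addn0 // => f.
by rewrite mem_cons_of negbK => /eqP->; rewrite cards0.
Qed.

Lemma sum_vbls_vdeg A : (\sum_(i in vbls_of A) vdeg A i = #|A|)%N.
Proof.
rewrite -sum_vdeg [RHS](bigID [in vbls_of A]) /= [X in (_ + X)%N]big1 ?addn0 // => i.
by rewrite mem_vbls_of -eqn0Ngt => /eqP->.
Qed.

(* Credits minus the variable part of debits is the sum of 2 - deg over the   *)
(* variables: a leaf gives 1, and any other variable gives - (deg - 2).       *)
Lemma revenueE tau A : revenue tau A =
  2 * #|vbls_of A|%:Z - #|A|%:Z - \sum_(f in cons_of A) (#|nbrs A f|%:Z - tau%:Z).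
Proof.
rewrite /revenue /debits opprD addrA; congr (_ - _).
have -> : credits A = \sum_(i in vbls_of A) (vdeg A i == 1%N)%:Z.
  rewrite /credits -sum1_card Posz_sum.
  rewrite [RHS]big_mkcond [LHS]big_mkcond; apply: eq_bigr => i _.
  by rewrite inE mem_vbls_of; case: (vdeg A i) => [|[|?]].
rewrite -sum_vbls_vdeg -sum1_card !Posz_sum mulr_sumr -!sumrB.
apply: eq_bigr => i; rewrite mem_vbls_of => d; lia.
Qed.

End EdgeCounts.

(** * Consequences of plausibility *)

Section Expansion.

Variables (R : realFieldType) (Omega F : finType) (n : nat).
Variable G : factor_graph R Omega F n.
Variables (tau : nat) (SMALL zeta : R).
Hypothesis tau_gt0 : (0 < tau)%N.
Hypothesis SMALL_ge0 : 0 <= SMALL.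
Hypothesis zeta_gt0 : 0 < zeta.
Hypothesis plausG : plausibility_assumption G tau SMALL zeta.
Implicit Types (A B : {set F * 'I_n}) (f : F) (C : {set F}) (S T X : {set 'I_n}).

Definition full C : {set F * 'I_n} := restrict C (edges G).
Definition nbhd C : {set 'I_n} := vbls_of (full C).
(** By [revenueE], the revenue of [full C] is twice [#|nbhd C|] minus the sum of these weights over
    [C]; [wide] makes the truncated subtraction exact. *)
Definition wt f : nat := (2 * arity G f - tau)%N.
Definition wide C : bool := [forall f in C, (tau <= arity G f)%N].

Lemma nbrs_full C f : f \in C -> nbrs (full C) f = [set i in scope G f].
Proof. by move=> fC; rewrite nbrs_restrict fC; apply/setP => i; rewrite !inE. Qed.

Lemma card_nbrs_full C f : f \in C -> #|nbrs (full C) f| = arity G f.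
Proof.
move=> fC; rewrite nbrs_full // cardsE.
by rewrite (card_uniqP (scope_uniq G f)) size_tuple.
Qed.

Lemma card_nbrs_le A f : A \subset edges G -> (#|nbrs A f| <= arity G f)%N.
Proof.
move=> sA; rewrite -(size_tuple (scope G f)) -(card_uniqP (scope_uniq G f)).
exact/subset_leq_card/nbrs_edges.
Qed.

Lemma cons_of_full C : wide C -> cons_of (full C) = C.
Proof.
move=> /forall_inP wC; apply/setP => f; rewrite mem_cons_of.
case: (boolP (f \in C)) => fC; last by rewrite nbrs_restrict (negPf fC) eqxx.
by rewrite -card_gt0 card_nbrs_full // (leq_trans tau_gt0) ?wC.
Qed.

Lemma nbhdU C C' : nbhd (C :|: C') = nbhd C :|: nbhd C'.
Proof.
rewrite /nbhd -imsetU; congr (vbls_of _); apply/setP => e.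
by rewrite !inE; case: (_ \in C); case: (_ \in C'); rewrite ?andbT ?andbF ?orbF ?orbb.
Qed.

Lemma sum_wtU C C' : [disjoint C & C'] ->
  (\sum_(f in C :|: C') wt f = \sum_(f in C) wt f + \sum_(f in C') wt f)%N.
Proof. by move=> dC; rewrite -bigU //; apply: eq_bigl => f; rewrite inE. Qed.

Lemma wideU C C' : wide C -> wide C' -> wide (C :|: C').
Proof.
move=> /forall_inP wC /forall_inP wC'; apply/forall_inP => f.
by rewrite inE => /orP[/wC|/wC'].
Qed.

Lemma tau_subgraphU A B :
  tau_subgraph G tau A -> tau_subgraph G tau B -> tau_subgraph G tau (A :|: B).
Proof.
move=> /andP[sA /forall_inP tA] /andP[sB /forall_inP tB].
rewrite /tau_subgraph subUset sA sB; apply/forall_inP => f.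
rewrite cons_ofU inE nbrsU => /orP[/tA|/tB] /leq_trans -> //.
  exact/subset_leq_card/subsetUl.
exact/subset_leq_card/subsetUr.
Qed.

Lemma tau_subgraph0 : tau_subgraph G tau set0.
Proof.
by rewrite /tau_subgraph sub0set; apply/forall_inP => f; rewrite cons_of0 inE.
Qed.

Lemma tau_subgraph_wide A : tau_subgraph G tau A -> wide (cons_of A).
Proof.
move=> /andP[sA /forall_inP tA]; apply/forall_inP => f /tA /leq_trans -> //.
exact: card_nbrs_le.
Qed.

Lemma tau_subgraph_full C : wide C -> tau_subgraph G tau (full C).
Proof.
move=> wC; rewrite /tau_subgraph restrict_sub cons_of_full //=.
by apply/forall_inP => f fC; rewrite card_nbrs_full // (forall_inP wC).
Qed.

Lemma tau_subgraph_restrict C A :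
  tau_subgraph G tau A -> tau_subgraph G tau (restrict C A).
Proof.
move=> /andP[sA /forall_inP tA].
rewrite /tau_subgraph (subset_trans (restrict_sub C A)) //=.
apply/forall_inP => f; rewrite cons_of_restrict nbrs_restrict inE => /andP[fA ->].
exact: tA.
Qed.

Lemma full_plausible C : wide C -> #|C|%:R <= 2 * SMALL ->
  zeta * #|C|%:R + (\sum_(f in C) wt f)%N%:R <= (2 * #|nbhd C|)%N%:R.
Proof.
move=> wC cC; have := plausG (tau_subgraph_full wC).
rewrite cons_of_full // => /(_ cC); rewrite /plausible /income revenueE cons_of_full //.
rewrite subr_ge0 -[X in _ - X%:Z]sum_cons_nbrs cons_of_full //.
set r := (X in X%:~R) => h.
have : r <= (2 * #|nbhd C|)%N%:Z - (\sum_(f in C) wt f)%N%:Z.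
  rewrite /r !Posz_sum -/(nbhd C) -addrA -opprD -big_split /= lerD2l lerN2.
  apply: ler_sum => f fC; rewrite card_nbrs_full //.
  by have := forall_inP wC f fC; rewrite /wt; clear; lia.
by rewrite -(ler_int R) => hr; have := le_trans h hr; rewrite rmorphB /= lerBrDr.
Qed.

(* Completing the neighbourhoods of the constraints of B costs at most 2 per  *)
(* added edge, which the weights of the constraints pay for; double counting  *)
(* the edges of B does the rest, since a variable outside X and T lies on at  *)
(* least two of them.                                                         *)
Lemma boundary_count B X T : tau_subgraph G tau B -> leaves B \subset X :|: T ->
  (2 * #|nbhd (cons_of B) :\: X| + #|vbls_of B :&: X| <=
   #|T :\: X| + \sum_(f in cons_of B) wt f)%N.
Proof.
move=> tB lB; have wB := tau_subgraph_wide tB; case/andP: tB => sB /forall_inP tB.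
(* A variable outside [X] reached by the completion lies in [B] already or ends an edge that some
   constraint of [B] lacks. *)
have le1 : (#|nbhd (cons_of B) :\: X| <= #|vbls_of B :\: X|
    + \sum_(f in cons_of B) (arity G f - #|nbrs B f|))%N.
  have sub : nbhd (cons_of B) :\: X \subset (vbls_of B :\: X) :|:
      \bigcup_(f in cons_of B) (nbrs (full (cons_of B)) f :\: nbrs B f).
    apply/subsetP => i; rewrite in_setU !in_setD => /andP[iX /imsetP[[f j] fj /= ij]].
    rewrite {}ij in iX *; rewrite iX /=; case: (boolP (j \in vbls_of B)) => //= jB.
    have fC : f \in cons_of B by move: fj; rewrite inE => /andP[].
    apply/bigcupP; exists f => //; rewrite in_setD [in X in _ && X]inE fj andbT.
    by apply: contra jB; apply/subsetP/nbrs_sub_vbls.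
  apply: leq_trans (subset_leq_card sub) _; apply: leq_trans (leq_card_setU _ _) _.
  rewrite leq_add2l; elim/big_rec2: _ => [|f m A fB leA]; first by rewrite cards0.
  apply: leq_trans (leq_card_setU _ _) _; apply: leq_add => //.
  rewrite cardsD card_nbrs_full // (setIidPr _) //.
  by rewrite nbrs_full //; apply/subsetP => i; rewrite inE => /(subsetP sB); rewrite !inE.
have le2 : (2 * #|vbls_of B :\: X| <=
    #|T :\: X| + \sum_(i in vbls_of B :\: X) vdeg B i)%N.
  rewrite mulnC -sum_nat_const -sum1_card.
  have: (\sum_(i in vbls_of B :\: X) (i \in T) <= \sum_(i in T :\: X) 1)%N.
    rewrite big_mkcond [leqRHS]big_mkcond; apply: leq_sum => i _; rewrite !in_setD.
    by case: (i \in X); case: (i \in T); case: (i \in vbls_of B).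
  rewrite -(leq_add2r (\sum_(i in vbls_of B :\: X) vdeg B i)); apply: leq_trans.
  rewrite -big_split; apply: leq_sum => i /=; rewrite in_setD mem_vbls_of => /andP[iX di].
  case: (ltngtP (vdeg B i) 1%N) di => // [d2 _|d1 _]; first by rewrite addnC ltn_addr.
  have := subsetP lB i; rewrite inE d1 eqxx inE (negPf iX) /= => /(_ isT) ->.
  by [].
have le3 : (#|vbls_of B :&: X| <= \sum_(i in vbls_of B :&: X) vdeg B i)%N.
  by rewrite -sum1_card; apply: leq_sum => i; rewrite inE mem_vbls_of => /andP[].
have eq4 : (\sum_(i in vbls_of B :\: X) vdeg B i + \sum_(i in vbls_of B :&: X) vdeg B i
    = \sum_(f in cons_of B) #|nbrs B f|)%N.
  rewrite sum_cons_nbrs -sum_vbls_vdeg [in RHS](bigID [in X]) addnC /=; congr (_ + _)%N.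
    by apply: eq_bigl => i; rewrite inE.
  by apply: eq_bigl => i; rewrite inE andbC.
have le5 : (2 * \sum_(f in cons_of B) (arity G f - #|nbrs B f|) +
    \sum_(f in cons_of B) #|nbrs B f| <= \sum_(f in cons_of B) wt f)%N.
  rewrite big_distrr -big_split; apply: leq_sum => f fB /=.
  have arith (a b : nat) : (tau <= b <= a)%N -> (2 * (a - b) + b <= 2 * a - tau)%N.
    by clear; lia.
  by apply: arith; rewrite tB // card_nbrs_le.
by clear -le1 le2 le3 eq4 le5; lia.
Qed.

(* Completing S to S :|: nbhd C does not increase the revenue bound 2 * #|S|. *)
Definition tight S C : bool :=
  [&& wide C, #|C|%:R <= SMALL & (2 * #|nbhd C :\: S| <= \sum_(f in C) wt f)%N].

(** Deleting the edges at [C] changes degrees only inside [X], so no leaf is created outside it. *)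
Lemma leaves_restrictC X T C B : B \subset edges G -> nbhd C \subset X ->
  leaves B \subset X :|: T -> leaves (restrict (~: C) B) \subset X :|: T.
Proof.
move=> sB sCX lB; apply/subsetP => i iB'; rewrite inE; case: (boolP (i \in X)) => //= iX.
have : i \in leaves B.
  move: iB'; rewrite !inE => /eqP <-; apply/eqP/eq_card => f; rewrite !inE /=.
  case: (boolP (_ \in B)) => //= fB; apply/esym.
  apply: contra iX => fC; apply: (subsetP sCX); apply/imsetP; exists (f, i) => //.
  by have := subsetP sB _ fB; rewrite !inE fC andbT.
by move/(subsetP lB); rewrite inE (negPf iX).
Qed.

(** Plausibility is applied to the completion of [C] together with the constraints of [B] outside
    [C]. By tightness the weights of [C] pay for enlarging [S] to [X]; by [boundary_count] the
    remaining weights pay for the rest up to [#|T|]. *)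
Lemma closed_size S C B T : let X := S :|: nbhd C in tight S C ->
  tau_subgraph G tau B -> leaves B \subset X :|: T ->
  #|C :|: cons_of B|%:R <= 2 * SMALL ->
  zeta * #|C :|: cons_of B|%:R <= (2 * #|S| + #|T|)%N%:R.
Proof.
move=> X /and3P[wC _ tC] tB lB; have [sB _] := andP tB.
pose B' := restrict (~: C) B; have tB' : tau_subgraph G tau B'.
  exact: tau_subgraph_restrict.
have -> : C :|: cons_of B = C :|: cons_of B'.
  by apply/setP => f; rewrite cons_of_restrict !inE; case: (f \in C); rewrite ?andbT.
move=> /(full_plausible (wideU wC (tau_subgraph_wide tB'))).
have lB' : leaves B' \subset X :|: T by apply: leaves_restrictC => //; exact: subsetUr.
have := boundary_count tB' lB'.
rewrite sum_wtU; last first.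
  rewrite -setI_eq0; apply/eqP/setP => f; rewrite cons_of_restrict !inE.
  by case: (f \in C); rewrite ?andbF.
have : (#|nbhd (C :|: cons_of B')| <=
    #|S| + #|nbhd C :\: S| + #|nbhd (cons_of B') :\: X|)%N.
  have sub : nbhd (C :|: cons_of B') \subset
      S :|: (nbhd C :\: S) :|: (nbhd (cons_of B') :\: X).
    apply/subsetP => i; rewrite nbhdU !in_setU !in_setD /X !in_setU.
    by case: (i \in S) => //=; case: (i \in nbhd C); rewrite ?orbT.
  apply: leq_trans (subset_leq_card sub) _; apply: leq_trans (leq_card_setU _ _) _.
  by rewrite leq_add2r leq_card_setU.
have : (#|T :\: X| <= #|T|)%N by apply/subset_leq_card/subsetDl.
set m := #|_ :|: _|; move=> h1 h2 h3 h4.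
rewrite -(lerD2r (\sum_(f in C) wt f + \sum_(f in cons_of B') wt f)%N%:R).
by apply: le_trans h4 _; rewrite -natrD ler_nat; clear -h1 h2 h3 tC; lia.
Qed.

Lemma closed_small S C B T : let X := S :|: nbhd C in tight S C ->
  tau_subgraph G tau B -> leaves B \subset X :|: T ->
  (2 * #|S| + #|T|)%N%:R <= zeta * SMALL ->
  #|C :|: cons_of B|%:R <= 2 * SMALL -> #|C :|: cons_of B|%:R <= SMALL.
Proof.
move=> X tC tB lB le_ST /(closed_size tC tB lB)/le_trans/(_ le_ST).
by rewrite ler_pM2l.
Qed.

Lemma closure_small S C T : let X := S :|: nbhd C in tight S C ->
  (2 * #|S| + #|T|)%N%:R <= zeta * SMALL ->
  let Q := closure_of G tau SMALL (X :|: T) in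
  closed_for G tau (X :|: T) Q /\ #|C :|: cons_of Q|%:R <= SMALL.
Proof.
move=> X tC le_ST Q; have cC : #|C|%:R <= SMALL by case/and3P: tC.
suff /andP[] : closed_for G tau (X :|: T) Q && (#|C :|: cons_of Q|%:R <= SMALL) by [].
have cardU (a b c d : {set F}) : #|a|%:R <= SMALL -> #|b|%:R <= SMALL ->
    c :|: d = a :|: b -> #|c :|: d|%:R <= 2 * SMALL.
  move=> ha hb ->; have : (#|a :|: b| <= #|a| + #|b|)%N by exact: leq_card_setU.
  rewrite -(ler_nat R) natrD mulr_natl mulr2n => /le_trans-> //; exact: lerD.
rewrite /Q /closure_of; apply: (big_ind (fun E =>
  closed_for G tau (X :|: T) E && (#|C :|: cons_of E|%:R <= SMALL))) => [|A B|A].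
- rewrite /closed_for tau_subgraph0 cons_of0 setU0 cC andbT.
  by rewrite leaves0 sub0set.
- move=> /andP[/andP[tA lA] cA] /andP[/andP[tB lB] cB].
  have tAB := tau_subgraphU tA tB.
  have lAB : leaves (A :|: B) \subset X :|: T.
    by apply: subset_trans (leavesU A B) _; rewrite subUset lA lB.
  rewrite /closed_for tAB lAB /=; apply: closed_small tC tAB lAB le_ST _.
  by apply: cardU cA cB _; rewrite cons_ofU setUACA setUid.
move=> /andP[/andP[tA lA] cA]; rewrite /closed_for tA lA /=.
by apply: closed_small tC tA lA le_ST _; apply: cardU cC cA _.
Qed.

Lemma tight0 S : tight S set0.
Proof.
rewrite /tight cards0 SMALL_ge0 /=; apply/andP; split.
  by apply/forall_inP => f; rewrite inE.
have -> : nbhd set0 = set0.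
  by apply/setP => i; apply/idP/idP => [/imsetP[e]|]; rewrite !inE ?andbF.
by rewrite set0D cards0.
Qed.

Lemma exists_max_tight S :
  exists2 C, tight S C & forall C', tight S C' -> (#|C'| <= #|C|)%N.
Proof. by case: (arg_maxnP (fun C : {set F} => #|C|) (tight0 S)) => C tC hC; exists C. Qed.

(** If [B] met [X] in at least [#|T :\: X|] variables, [boundary_count] would make [C :|: cons_of B]
    tight, against the maximality of [C]. *)
Lemma boundary_lt S C B T : let X := S :|: nbhd C in tight S C ->
  (forall C', tight S C' -> (#|C'| <= #|C|)%N) ->
  tau_subgraph G tau B -> leaves B \subset X :|: T -> [disjoint C & cons_of B] ->
  #|C :|: cons_of B|%:R <= SMALL -> B != set0 ->
  (#|(T :|: vbls_of B) :&: X| < #|T|)%N.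
Proof.
move=> X /and3P[wC cC tC] maxC tB lB dCB cCB B0.
have ltB : (#|vbls_of B :&: X| < #|T :\: X|)%N.
  rewrite ltnNge; apply/negP => leTB; have := boundary_count tB lB.
  have : (#|nbhd (C :|: cons_of B) :\: S| <= #|nbhd C :\: S| + #|nbhd (cons_of B) :\: X|)%N.
    apply: leq_trans (leq_card_setU _ _); apply/subset_leq_card/subsetP => i.
    rewrite nbhdU !in_setU !in_setD !in_setU.
    by case: (i \in S) => //=; case: (i \in nbhd C).
  move=> h1 h2; suff /maxC : tight S (C :|: cons_of B).
    rewrite cardsU (disjoint_setI0 dCB) cards0 subn0 -[leqRHS]addn0 leq_add2l leqn0.
    by rewrite cards_eq0 cons_of_eq0 (negPf B0).
  apply/and3P; split=> //; first by apply: wideU (tau_subgraph_wide tB).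
  by rewrite sum_wtU //; clear -leTB tC h1 h2; lia.
rewrite setIUl; apply: leq_ltn_trans (leq_card_setU _ _) _.
by rewrite -(cardsID X T) ltn_add2l.
Qed.

End Expansion.

(** * Planted distributions *)

Lemma sum_fprod_prod (R : comNzRingType) (I : finType) (T_ : I -> finType)
    (P_ : forall i, T_ i -> R) :
  \sum_(t : fprod T_) \prod_i P_ i (t i) = \prod_i \sum_(j : T_ i) P_ i j.
Proof.
transitivity (\sum_(t : fprod T_) \prod_(i in I) [ffun j => P_ i j] (t i)).
  by apply: eq_bigr => t _; apply: eq_bigr => i _; rewrite ffunE.
rewrite (big_fprod 1 _ (fun i => [ffun j => P_ i j])); symmetry.
transitivity (\prod_i \sum_(j in tagged_with T_ i) untag 0 [ffun j => P_ i j] j).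
  apply: eq_bigr => i _; rewrite -(big_tag (fun i => [ffun j => P_ i j])).
  by apply: eq_bigr => j _; rewrite ffunE.
exact: bigA_distr_big_dep.
Qed.

Section Planted.

Variables (R : realFieldType) (Omega F : finType) (n : nat).
Variable G : factor_graph R Omega F n.
Hypothesis q_gt0 : (0 < #|Omega|)%N.
Local Notation point := {ffun 'I_n -> Omega}.
Local Notation q := (#|Omega|%:R : R).
Implicit Types (A : {set F * 'I_n}) (x : point) (U : {set 'I_n}).

Lemma prod_natr_bool (I : finType) (P : pred I) :
  \prod_i (P i)%:R = [forall i, P i]%:R :> R.
Proof.
case: (boolP [forall i, P i]) => [/forallP hP|/forallPn[i /negPf hi]].
  by apply: big1 => i _; rewrite hP.
by rewrite (bigD1 i) //= hi mul0r.
Qed.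

Lemma sum_agreeing U (x0 : point) :
  \sum_(x : point) [forall i in U, x i == x0 i]%:R = \prod_(i | i \notin U) q :> R.
Proof.
transitivity (\sum_(x : point) \prod_i ((i \in U) ==> (x i == x0 i))%:R : R).
  by apply: eq_bigr => x _; rewrite prod_natr_bool.
rewrite -(bigA_distr_bigA (fun i c => ((i \in U) ==> (c == x0 i))%:R)).
rewrite [RHS]big_mkcond; apply: eq_bigr => i _; case: (i \in U) => /=.
  by rewrite (bigD1 (x0 i)) //= eqxx big1 ?addr0 // => c /negPf->.
by rewrite sumr_const.
Qed.

(** Matching [x] is a separate condition on each [w f], so independence factorises the sum. *)
Lemma sum_draws_match A x :
  \sum_(w : draws G A | draws_match w x) draws_prob w =
  \prod_(f in cons_of A) marg G f (nbrs A f) x.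
Proof.
pose P (f : {f | f \in cons_of A}) (w : (arity G (val f)).-tuple Omega) : R :=
  (compat (nbrs A (val f)) x w)%:R * mu G w.
transitivity (\sum_(w : draws G A) \prod_f P f (w f)).
  rewrite big_mkcond; apply: eq_bigr => w _; rewrite big_split /= prod_natr_bool.
  have -> : draws_match w x = [forall f, compat (nbrs A (val f)) x (w f)].
    by apply: eq_forallb => f; apply: eq_forallb => j; rewrite inE.
  by case: forallP => _; rewrite ?mul1r ?mul0r.
rewrite sum_fprod_prod [RHS]big_sub; apply: eq_bigr => f _.
rewrite /marg [RHS]big_mkcond; apply: eq_bigr => w _; rewrite /P.
by case: (compat _ _ _); rewrite ?mul1r ?mul0r.
Qed.

Lemma draws_match_agree A (w : draws G A) x : draws_match w x -> draws_agree w.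
Proof.
move=> /forallP xw; apply/forallP => f; apply/forallP => j.
apply/forallP => f'; apply/forallP => j'; apply/implyP => /and3P[fA fA' /eqP e].
have /forallP/(_ j)/implyP/(_ fA)/eqP <- := xw f.
have /forallP/(_ j')/implyP/(_ fA')/eqP <- := xw f'.
by rewrite e.
Qed.

Lemma agree_match A (w : draws G A) : draws_agree w -> exists x, draws_match w x.
Proof.
move=> /forallP aw; have [c0 _] : exists c0 : Omega, true.
  by move/card_gt0P: q_gt0 => [c0 _]; exists c0.
pose suggests i (p : {f : {f | f \in cons_of A} & 'I_(arity G (val f))}) :=
  let: existT f j := p in
  ((val f, tnth (scope G (val f)) j) \in A) && (tnth (scope G (val f)) j == i).
(* Any suggestion made to [i] will do, since all of them agree; [c0] fills the variables without
   one. *)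
exists [ffun i => if [pick p | suggests i p] is Some (existT f j)
                  then tnth (w f) j else c0].
apply/forallP => f; apply/forallP => j; apply/implyP => fA; rewrite ffunE.
case: pickP => [[f' j'] /= /andP[fA' e]|/(_ (existT _ f j))]; last by rewrite /= fA eqxx.
have /forallP/(_ j')/forallP/(_ f)/forallP/(_ j)/implyP := aw f'; apply.
by rewrite fA' fA e.
Qed.

Lemma draws_matchE A (w : draws G A) x0 x : A \subset edges G -> draws_match w x0 ->
  draws_match w x = [forall i in vbls_of A, x i == x0 i].
Proof.
move=> sA /forallP wx0; apply/forallP/forall_inP => [wx i|xx0 f].
  move=> /imsetP[[f {}i] eA /= ->]; have fA : f \in cons_of A by apply/imsetP; exists (f, i).
  have /tnthP[j ej] : i \in scope G f by have := subsetP sA _ eA; rewrite inE.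
  have /forallP/(_ j) := wx (exist _ f fA); have /forallP/(_ j) := wx0 (exist _ f fA).
  by rewrite /= -ej eA => /eqP-> /eqP->.
apply/forallP => j; apply/implyP => eA.
have /forallP/(_ j)/implyP/(_ eA)/eqP <- := wx0 f.
by apply: xx0; apply/imsetP; exists (val f, tnth (scope G (val f)) j).
Qed.

(** The pairs of a point and a matching draw are summed in both orders: an agreeing draw fixes the
    point on [vbls_of A] and leaves it free elsewhere. *)
Lemma sum_prod_marg A : A \subset edges G ->
  \sum_(x : point) \prod_(f in cons_of A) marg G f (nbrs A f) x =
  agree_prob G A * \prod_(i | i \notin vbls_of A) q.
Proof.
move=> sA; transitivity (\sum_(x : point) \sum_(w : draws G A | draws_match w x) draws_prob w).
  by apply: eq_bigr => x _; rewrite sum_draws_match.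
rewrite (exchange_big_dep (@draws_agree _ _ _ _ G A)) /=; last first.
  by move=> x w _; apply: draws_match_agree.
rewrite mulr_suml; apply: eq_bigr => w aw; have [x0 wx0] := agree_match aw.
rewrite -(sum_agreeing _ x0) mulr_sumr big_mkcond; apply: eq_bigr => x _.
by rewrite (draws_matchE _ sA wx0); case: ifP => _; rewrite ?mulr1 ?mulr0.
Qed.

Lemma densE A x : dens G A x =
  q ^+ #|A| * \prod_(f in cons_of A) marg G f (nbrs A f) x.
Proof.
rewrite /dens big_split /= -(sum_nbrs A) -prodrXr; congr (_ * _).
rewrite [RHS]big_mkcond; apply: eq_bigr => f _; rewrite mem_cons_of.
by case: eqP => //= ->; rewrite marg0.
Qed.

Lemma planted_expectationE A (g : point -> R) : A \subset edges G ->
  planted_expectation G A g = (\sum_x g x * dens G A x) / \sum_x dens G A x.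
Proof.
move=> sA; have qA : q ^+ #|A| != 0 by rewrite expf_neq0 // pnatr_eq0 -lt0n.
under [in RHS]eq_bigr do rewrite densE mulrCA.
under [X in _ / X]eq_bigr do rewrite densE.
rewrite -!mulr_sumr sum_prod_marg // -mulf_div divff // mul1r mulr_suml.
apply: eq_bigr => x _; rewrite mulrC -mulrA; congr (_ * _).
rewrite /planted prodfV invfM mulrA; congr (_ / _ * _).
rewrite -sum_draws_match; apply: eq_bigl => w.
by apply: andb_idl; apply: draws_match_agree.
Qed.

End Planted.

(** * The signed density of the pseudo-expectation *)

Section PseudoDensity.

Variables (R : realFieldType) (Omega F : finType) (n : nat).
Variable G : factor_graph R Omega F n.
Variables (tau : nat) (SMALL zeta : R).
Hypothesis q_gt0 : (0 < #|Omega|)%N.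
Hypothesis arityG : forall f, (tau.-1 <= arity G f)%N.
Hypothesis uniformG : forall f, wise_uniform tau.-1 (@mu R Omega F n G f).
Hypothesis tau_gt0 : (0 < tau)%N.
Hypothesis SMALL_ge0 : 0 <= SMALL.
Hypothesis zeta_gt0 : 0 < zeta.
Hypothesis plausG : plausibility_assumption G tau SMALL zeta.
Local Notation point := {ffun 'I_n -> Omega}.
Local Notation q := (#|Omega|%:R : R).
Implicit Types (A B H : {set F * 'I_n}) (x : point) (Y S T : {set 'I_n}).

(** Either [B] is no tau-subgraph and [chi] vanishes, or [B] has a leaf that [g] does not see and
    summing over its value gives zero. *)
Lemma sum_chi_eq0 Y B (g : point -> R) : depends_on Y g -> B \subset edges G ->
  ~~ closed_for G tau Y B -> \sum_x g x * chi G B x = 0.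
Proof.
move=> gY sB; rewrite /closed_for negb_and => /orP[nt|/subsetPn[i iB iY]].
  by apply: big1 => x _; rewrite (chi_tau q_gt0 _ arityG uniformG sB nt) mulr0.
by apply: (mean0_sum (i := i)) => //; apply: mean0M gY iY _; apply: chi_mean0.
Qed.

(* May take negative values.                                                  *)
Definition pseudo_dens x : R :=
  \sum_(B | tau_subgraph G tau B && small SMALL B) chi G B x.

(** Only the components of [Y]-closed sets survive on either side, and among these the small ones
    are exactly those inside [H]: small ones lie in the closure, and subsets of [H] are small
    because [H] is. *)
Lemma sum_pseudo_dens Y H (g : point -> R) : depends_on Y g -> H \subset edges G ->
  small SMALL H -> closure_of G tau SMALL Y \subset H ->
  \sum_x g x * pseudo_dens x = \sum_x g x * dens G H x.
Proof.
move=> gY sH smH clH.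
transitivity (\sum_(B | closed_for G tau Y B && small SMALL B)
    \sum_x g x * chi G B x).
  under eq_bigr do rewrite mulr_sumr.
  rewrite exchange_big /= (bigID (closed_for G tau Y)) /= addrC big1 ?add0r.
    apply: eq_bigl => B; rewrite /closed_for.
    by case: (tau_subgraph _ _ _); case: (small _ _); rewrite ?andbT ?andbF.
  by move=> B /andP[/andP[/andP[sB _] _]]; apply: sum_chi_eq0.
under [RHS]eq_bigr do rewrite -sum_chi mulr_sumr.
rewrite [RHS]exchange_big /= [RHS](bigID (closed_for G tau Y)) /= addrC [X in _ = X + _]big1 ?add0r.
  apply: eq_bigl => B; rewrite andbC; case: (boolP (closed_for _ _ _ _)) => cB; last first.
    by rewrite !andbF.
  rewrite !andbT; apply/idP/idP => [smB|sBH].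
    by apply: subset_trans clH; apply: bigcup_sup; rewrite cB smB.
  by apply: le_trans smH; rewrite ler_nat; apply/subset_leq_card/cons_ofS.
by move=> B /andP[sBH]; apply: sum_chi_eq0; rewrite ?(subset_trans sBH).
Qed.

(** With no leaves available, [closed_size] bounds [zeta * #|cons_of B|] by 0. *)
Lemma closed_for0 B : closed_for G tau set0 B -> small SMALL B -> B = set0.
Proof.
move=> /andP[tB]; rewrite subset0 => /eqP lB smB; apply/eqP.
have := closed_size (T := set0) tau_gt0 plausG (tight0 G tau SMALL_ge0 set0) tB.
rewrite lB sub0set => /(_ isT); rewrite set0U !cards0.
have sm2 : #|cons_of B|%:R <= 2 * SMALL by apply: le_trans smB _; rewrite mulr_natl mulr2n lerDl.
move=> /(_ sm2); rewrite pmulr_rle0 // -cons_of_eq0 -cards_eq0.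
by rewrite (_ : 0 = 0%:R) // ler_nat leqn0.
Qed.

Lemma sum_pseudo_dens1 : \sum_x pseudo_dens x = #|{: point}|%:R.
Proof.
have dep0 : depends_on set0 (fun _ : point => 1 : R) by [].
have cl0 : closure_of G tau SMALL set0 \subset set0.
  apply/bigcupsP => B /andP[cB smB]; rewrite (closed_for0 cB smB) sub0set //.
have := sum_pseudo_dens dep0 (sub0set _) _ cl0.
rewrite /small cons_of0 cards0 => /(_ SMALL_ge0).
under eq_bigr do rewrite mul1r; move=> ->.
by under eq_bigr do rewrite dens_set0 mulr1; rewrite sumr_const.
Qed.

Lemma closure_size T : #|T|%:R <= zeta * SMALL ->
  closed_for G tau T (closure_of G tau SMALL T) /\ small SMALL (closure_of G tau SMALL T).
Proof.
move=> le_T.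
have := closure_small (T := T) tau_gt0 zeta_gt0 plausG (tight0 G tau SMALL_ge0 set0).
have -> : nbhd G set0 = set0.
  by apply/setP => i; apply/idP/idP => [/imsetP[e]|]; rewrite !inE ?andbF.
by rewrite !set0U cards0 muln0 add0n => /(_ le_T) /=; rewrite set0U.
Qed.

(** The closure density may be traded for [pseudo_dens] against [g] and also against the constant 1,
    which makes the normalising constant the same for every [T]. *)
Lemma planted_closureE T (g : point -> R) : depends_on T g -> #|T|%:R <= zeta * SMALL ->
  planted_expectation G (closure_of G tau SMALL T) g =
  (\sum_x g x * pseudo_dens x) / #|{: point}|%:R.
Proof.
move=> gT /closure_size[/andP[/andP[sQ _] _] smQ]; set Q := closure_of _ _ _ _ in sQ smQ *.
rewrite planted_expectationE // (sum_pseudo_dens gT sQ smQ) //; congr (_ / _).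
rewrite -sum_pseudo_dens1.
have dep0 : depends_on set0 (fun _ : point => 1 : R) by [].
have cl0 : closure_of G tau SMALL set0 \subset Q.
  by apply/bigcupsP => B /andP[cB smB]; rewrite (closed_for0 cB smB) sub0set.
have := sum_pseudo_dens dep0 sQ smQ cl0.
by under eq_bigr do rewrite mul1r; under [RHS]eq_bigr do rewrite mul1r.
Qed.

End PseudoDensity.

(** * Positivity *)

Section Projection.

Variables (R : realFieldType) (V : vectType R) (b : V -> V -> R).
Hypothesis bC : forall u v, b u v = b v u.
Hypothesis bD : forall u v w, b (u + v) w = b u w + b v w.
Hypothesis bZ : forall c u w, b (c *: u) w = c * b u w.
Hypothesis b_ge0 : forall u, 0 <= b u u.

Let bDr u v w : b u (v + w) = b u v + b u w. Proof. by rewrite bC bD !(bC u). Qed.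
Let bZr c u w : b u (c *: w) = c * b u w. Proof. by rewrite bC bZ (bC u). Qed.

Lemma psd_isotropic u v : b v v = 0 -> b u v = 0.
Proof.
move=> bv; apply/eqP/negPn/negP => buv.
(* Along [v] the quadratic form is affine with slope [2 * b u v]; this multiple of [v] brings its
   value to -1. *)
have := b_ge0 (u + (- (b u u + 1) / (2 * b u v)) *: v).
rewrite bD !bDr !bZ !bZr bv (bC v u).
have -> : b u u + - (b u u + 1) / (2 * b u v) * b u v +
   (- (b u u + 1) / (2 * b u v) * b u v +
    - (b u u + 1) / (2 * b u v) * (- (b u u + 1) / (2 * b u v) * 0)) = - 1 by field.
by rewrite oppr_ge0 ler10.
Qed.

(** Gram-Schmidt for a form that may be degenerate: when the new direction [v'] is isotropic, it is
    orthogonal to everything and needs no correction. *)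
Lemma exists_projection (s : seq V) g :
  exists2 h, h \in <<s>>%VS & forall v, v \in <<s>>%VS -> b (g - h) v = 0.
Proof.
have b0 u : b u 0 = 0 by rewrite -(scale0r 0) bZr mul0r.
elim: s g => [|v0 s IH] g.
  by exists 0; rewrite ?mem0v // => v; rewrite span_nil memv0 => /eqP->.
have [hv hvs hvP] := IH v0; have [hg hgs hgP] := IH g.
pose v' := v0 - hv; have sub : (<<s>> <= <<v0 :: s>>)%VS by rewrite span_cons addvSr.
have v's : v' \in <<v0 :: s>>%VS.
  by apply: memvB; [apply/memv_span/mem_head | apply: (subvP sub)].
have orth h : (forall w, w \in <<s>>%VS -> b h w = 0) -> b h v' = 0 ->
    forall v, v \in <<v0 :: s>>%VS -> b h v = 0.
  move=> hs hv' v; rewrite span_cons => /memv_addP[_ /vlineP[c ->] [w ws ->]].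
  have -> : c *: v0 + w = c *: v' + (c *: hv + w) by rewrite addrA -scalerDr subrK.
  by rewrite bDr bZr hv' mulr0 add0r hs // memvD ?memvZ.
have [bv0|bv0] := eqVneq (b v' v') 0.
  exists hg; first exact: (subvP sub).
  by apply: orth => //; apply: psd_isotropic.
exists (hg + (b (g - hg) v' / b v' v') *: v').
  by apply: memvD; [apply: (subvP sub) | apply: memvZ].
rewrite opprD addrA -scaleNr; apply: orth => [w ws|].
  by rewrite bD bZ (hgP w ws) (hvP w ws) mulr0 addr0.
by rewrite bD bZ mulNr divfK // subrr.
Qed.

End Projection.

(** * Vector spaces of local functions and weighted bilinear forms *)

Section LocalFunctions.

Variables (R : realFieldType) (Omega : finType) (n : nat).
Hypothesis q_gt0 : (0 < #|Omega|)%N.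
Local Notation point := {ffun 'I_n -> Omega}.
Local Notation V := {ffun point -> R^o}.
Implicit Types (U X : {set 'I_n}) (u v w : V) (P : {set {set 'I_n}}).

Lemma card_point_neq0 : #|{: point}|%:R != 0 :> R.
Proof. by rewrite pnatr_eq0 card_ffun expn_eq0 negb_and -lt0n q_gt0. Qed.

Definition avgf U u : V := [ffun x => avg U (u : point -> R) x].

Fact avgf_is_linear U : linear (avgf U).
Proof.
move=> c u v; apply/ffunP => x; rewrite !ffunE /avg scaler_sumr -big_split.
by apply: eq_bigr => y _; rewrite !ffunE.
Qed.

HB.instance Definition _ U := GRing.isLinear.Build R V V *:%R (avgf U) (avgf_is_linear U).

(** The functions of the variables in [U], obtained as a subspace because averaging multiplies each
    of them by the number of points. *)
Definition local_on U : {vspace V} := limg (linfun (avgf U)).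

Lemma local_onP U u : reflect (depends_on U (u : point -> R)) (u \in local_on U).
Proof.
apply: (iffP memv_imgP) => [[w _ ->]|uU].
  rewrite lfunE => x y xy; rewrite !ffunE.
  apply: (@avg_depends _ _ _ U setT (w : point -> R)) => [{}x {}y {}xy|i].
    by congr (w _); apply/ffunP => i; apply: xy; rewrite inE.
  by rewrite setIT => /xy.
exists (#|{: point}|%:R^-1 *: u); rewrite ?memvf // lfunE; apply/ffunP => x.
rewrite ffunE /avg (eq_bigr (fun=> #|{: point}|%:R^-1 * u x)) => [|y _].
  by rewrite sumr_const -[RHS]mulr_natl mulrA divff ?mul1r ?card_point_neq0.
by rewrite ffunE; congr (_ * _); apply: uU => i iU; rewrite ffunE iU.
Qed.

Lemma local_onS U X : U \subset X -> (local_on U <= local_on X)%VS.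
Proof. by move=> sUX; apply/subvP => u /local_onP/(depends_onS sUX)/local_onP. Qed.

Definition span_local P : {vspace V} := (\sum_(U in P) local_on U)%VS.

Definition wform (rho : point -> R) u v : R := \sum_x (u x : R) * v x * rho x.

Lemma wformC rho u v : wform rho u v = wform rho v u.
Proof. by apply: eq_bigr => x _; rewrite [u x * _]mulrC. Qed.

Lemma wformD rho u v w : wform rho (u + v) w = wform rho u w + wform rho v w.
Proof. by rewrite -big_split; apply: eq_bigr => x _; rewrite ffunE /= !mulrDl. Qed.

Lemma wformZ rho c u w : wform rho (c *: u) w = c * wform rho u w.
Proof. by rewrite mulr_sumr; apply: eq_bigr => x _; rewrite ffunE /= !mulrA. Qed.

Lemma wform_ge0 rho u : (forall x, 0 <= rho x) -> 0 <= wform rho u u.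
Proof.
by move=> rho_ge0; apply: sumr_ge0 => x _; rewrite mulr_ge0 // -expr2 sqr_ge0.
Qed.

End LocalFunctions.

Section Positivity.

Variables (R : realFieldType) (Omega F : finType) (n : nat).
Variable G : factor_graph R Omega F n.
Variables (tau : nat) (SMALL zeta : R).
Hypothesis q_gt0 : (0 < #|Omega|)%N.
Hypothesis arityG : forall f, (tau.-1 <= arity G f)%N.
Hypothesis uniformG : forall f, wise_uniform tau.-1 (@mu R Omega F n G f).
Hypothesis tau_gt0 : (0 < tau)%N.
Hypothesis SMALL_ge0 : 0 <= SMALL.
Hypothesis zeta_gt0 : 0 < zeta.
Hypothesis plausG : plausibility_assumption G tau SMALL zeta.
Local Notation point := {ffun 'I_n -> Omega}.
Local Notation V := {ffun point -> R^o}.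
Local Notation Phi := (pseudo_dens G tau SMALL).
Implicit Types (A B H : {set F * 'I_n}) (x : point) (X S T U : {set 'I_n}).
Implicit Types (C : {set F}) (P : {set {set 'I_n}}) (u v w t : V).

(** [E] consists of [C] and the constraints of the closure. Smallness counts constraints only, so
    all their edges may be included; the part at [C] is then exactly [full G C]. *)
Lemma sum_pseudo_dens_full S C T : let X := S :|: nbhd G C in
  tight G tau SMALL S C -> (2 * #|S| + #|T|)%N%:R <= zeta * SMALL ->
  exists E : {set F}, [/\ C \subset E, #|E|%:R <= SMALL &
    forall g : point -> R, depends_on (X :|: T) g ->
      \sum_x g x * Phi x = \sum_x g x * dens G (full G E) x].
Proof.
move=> X tC le_ST; have [] := closure_small tau_gt0 zeta_gt0 plausG tC le_ST.
rewrite -/X; set Q := closure_of _ _ _ _ => /andP[/andP[sQ _] _] smE.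
exists (C :|: cons_of Q); split=> // [|g gX]; first exact: subsetUl.
apply: (sum_pseudo_dens q_gt0 arityG uniformG gX); first exact: restrict_sub.
  rewrite /small; apply: le_trans smE; rewrite ler_nat.
  by rewrite cons_of_restrict; apply/subset_leq_card/subsetIr.
apply/subsetP => e eQ; rewrite inE (subsetP sQ) // inE.
by rewrite (_ : e.1 \in cons_of Q) ?orbT //; apply/imsetP; exists e.
Qed.

Lemma wform_local_ge0 S C u : let X := S :|: nbhd G C in
  tight G tau SMALL S C -> (2 * #|S|)%N%:R <= zeta * SMALL ->
  u \in local_on R Omega X -> 0 <= wform Phi u u.
Proof.
move=> X tC le_S /(local_onP q_gt0) uX.
have le_S0 : (2 * #|S| + #|set0 : {set 'I_n}|)%N%:R <= zeta * SMALL by rewrite cards0 addn0.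
have [E [_ _ repE]] := sum_pseudo_dens_full tC le_S0.
rewrite /wform repE; first by apply: wform_ge0 => x; apply: dens_ge0.
by rewrite setU0 -[X in depends_on X](setUid X); apply: depends_onM.
Qed.

(* Conditioning a function of T on the variables X turns it into functions of *)
(* fewer than #|T| variables of X, or of T itself when T is inside X; these   *)
(* are already orthogonal to w.                                               *)
Lemma local_orthogonal S C T P w t : let X := S :|: nbhd G C in
  tight G tau SMALL S C ->
  (forall C', tight G tau SMALL S C' -> (#|C'| <= #|C|)%N) ->
  (2 * #|S| + #|T|)%N%:R <= zeta * SMALL ->
  T \in P -> (forall U, (#|U| < #|T|)%N -> U \in P) ->
  w \in local_on R Omega X -> t \in local_on R Omega T ->
  (forall U v, U \in P -> U \subset X -> v \in local_on R Omega U ->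
    wform (dens G (full G C)) w v = 0) ->
  wform Phi w t = 0.
Proof.
move=> X tC maxC le_ST TP downP /(local_onP q_gt0) wX /(local_onP q_gt0) tT orth.
have [E [sCE smE repE]] := sum_pseudo_dens_full tC le_ST.
have sCX : nbhd G C \subset X by apply: subsetUr.
have fullE : restrict C (full G E) = full G C.
  apply/setP => e; rewrite !inE -andbA; congr (_ && _).
  by apply: andb_idl => /(subsetP sCE).
rewrite /wform repE; last exact: depends_onM.
pose A := restrict (~: C) (full G E).
have sA : A \subset edges G by apply: subset_trans (restrict_sub _ _) (restrict_sub _ _).
have wdX : depends_on X (fun x => (w x : R) * dens G (full G C) x).
  rewrite -(setUidPl sCX); apply: depends_onM => //; exact: dens_depends.
under eq_bigr do rewrite (dens_restrict G C) fullE -/A -(sum_chi G A) !mulr_sumr.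
rewrite exchange_big /=; apply: big1 => B sBA.
have sB := subset_trans sBA sA.
rewrite (eq_bigr (fun x => (w x * dens G (full G C) x * t x) * chi G B x)); last first.
  by move=> x _; rewrite -!mulrA; congr (_ * _); rewrite mulrCA.
have [/andP[tB lB]|/(sum_chi_eq0 q_gt0 arityG uniformG _ sB)->//] :=
  boolP (closed_for G tau (X :|: T) B); last exact: depends_onM.
pose Z := X :&: (T :|: vbls_of B).
have tauZ : depends_on Z (avg X (fun x => (t x : R) * chi G B x)).
  by apply: avg_depends; apply: depends_onM => //; apply: chi_depends.
(* For empty [B], [Z] is the part of [T] in [X], hence [T] or smaller; otherwise [boundary_lt] makes
   it smaller than [T]. *)
have ZP : Z \in P.
  have [B0|B0] := eqVneq B set0.
    have [sTX|nTX] := boolP (T \subset X).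
      rewrite /Z B0 /vbls_of imset0 setU0 (setIidPr sTX) //.
    apply: downP; rewrite /Z B0 /vbls_of imset0 setU0; apply: proper_card.
    by rewrite properEneq subsetIr andbT; apply: contra nTX => /eqP/setIidPr.
  apply: downP; rewrite /Z setIC; apply: (boundary_lt tC maxC) => //.
    rewrite -setI_eq0; apply/eqP/setP => f; rewrite !inE; apply/negbTE/negP.
    move=> /andP[fC /(subsetP (cons_ofS sBA))].
    by rewrite cons_of_restrict !inE fC andbF.
  apply: le_trans smE; rewrite ler_nat; apply: subset_leq_card.
  rewrite subUset sCE /=; apply: subset_trans (cons_ofS sBA) _.
  apply: subset_trans (cons_ofS (restrict_sub _ _)) _.
  by rewrite cons_of_restrict subsetIr.
(* The other factor depends on [X] only, so [t] times [chi] may be replaced by its average, a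
   function of [Z] to which [w] is orthogonal. *)
have := sum_avg (fun x => (t x : R) * chi G B x) wdX.
pose v : V := [ffun x => avg X (fun x => (t x : R) * chi G B x) x].
have -> : \sum_x w x * dens G (full G C) x * avg X (fun x => (t x : R) * chi G B x) x =
    wform (dens G (full G C)) w v.
  by apply: eq_bigr => x _; rewrite ffunE mulrAC.
rewrite (orth Z) ?subsetIl //; last first.
  by apply/(local_onP q_gt0) => x y xy; rewrite !ffunE; apply: tauZ.
move/esym/eqP; rewrite mulf_eq0 (negPf (card_point_neq0 _ _ q_gt0)) /= => /eqP h0.
rewrite -[RHS]h0; by apply: eq_bigr => x _; rewrite !mulrA.
Qed.

Lemma span_local_ge0 D P u : (3 * D)%N%:R <= zeta * SMALL ->
  (forall U, U \in P -> (#|U| <= D)%N) ->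
  (forall U T, T \in P -> (#|U| < #|T|)%N -> U \in P) ->
  u \in span_local R Omega P -> 0 <= wform Phi u u.
Proof.
move=> leD; have [k] := ubnP #|P|; elim: k P u => // k IH P u ltk leP downP.
have [->|[S0 S0P]] := set_0Vmem P.
  rewrite /span_local big_set0 memv0 => /eqP->.
  by apply: sumr_ge0 => x _; rewrite ffunE !mul0r.
have [S SP maxS] := arg_maxnP (fun U : {set 'I_n} => #|U|) S0P.
change (is_true (S \in P)) in SP.
pose P' := P :\ S.
have leP' : (#|P'| < k)%N by rewrite (cardsD1 S P) SP in ltk.
have downP' U T : T \in P' -> (#|U| < #|T|)%N -> U \in P'.
  (* A set smaller than a member of [P] cannot be [S], which has maximal size. *)
  rewrite !in_setD1 => /andP[_ TP] ltU; rewrite (downP U T) // andbT.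
  by apply: contraTneq ltU => ->; rewrite -leqNgt; apply: maxS.
have [C tC maxC] := exists_max_tight G tau SMALL_ge0 S.
set X := S :|: nbhd G C.
pose Y := (\sum_(U in P' | U \subset X) local_on R Omega U)%VS.
have sYX : (Y <= local_on R Omega X)%VS.
  by apply/subv_sumP => U /andP[_]; apply: local_onS.
have sYP : (Y <= span_local R Omega P')%VS.
  by apply/subv_sumP => U /andP[UP _]; apply: (sumv_sup U).
rewrite /span_local (big_setD1 S) //= -/P' -/(span_local R Omega P').
move=> /memv_addP[g gS [r rP ->]].
(* The projection uses the nonnegative density of [C]; that the remainder is also orthogonal for
   [Phi] is the content of [local_orthogonal]. *)
have [h + horth] := exists_projection (@wformC _ _ _ (dens G (full G C))) (@wformD _ _ _ _)
  (@wformZ _ _ _ _) (fun u => wform_ge0 u (@dens_ge0 _ _ _ _ G _)) (vbasis Y) g.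
rewrite (span_basis (vbasisP Y)) => hY.
rewrite (span_basis (vbasisP Y)) in horth.
pose w := g - h.
have wX : w \in local_on R Omega X.
  apply: memvB; last exact: (subvP sYX).
  exact: (subvP (local_onS R q_gt0 (subsetUl S _))).
have leS : (#|S| <= D)%N by apply: leP.
have w_orth y : y \in span_local R Omega P' -> wform Phi w y = 0.
  move=> /memv_sumP[ys ysP ->].
  have wform_sum : wform Phi w (\sum_(U in P') ys U) = \sum_(U in P') wform Phi w (ys U).
    rewrite wformC; elim/big_rec2: _ => [|U a b _ <-]; last by rewrite wformD wformC.
    by apply: big1 => x _; rewrite ffunE !mul0r.
  rewrite wform_sum big1 // => T TP'.
  have leT : (#|T| <= #|S|)%N by apply: maxS; move: TP'; rewrite inE => /andP[].
  apply: (local_orthogonal tC maxC _ TP' _ wX (ysP T TP')) => [|U|U v UP UX vU].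
  (* Here [2 * #|S| + #|T|] reaches [3 * D], the source of the factor 1/3 in the bound on the
     degree. *)
  - apply: le_trans leD; rewrite ler_nat; clear -leS leT; lia.
  - exact: downP'.
  - by apply: horth; apply: (subvP (sumv_sup U _ (subvv _))); rewrite ?UP.
have rhP : h + r \in span_local R Omega P' by apply: memvD => //; apply: (subvP sYP).
have -> : g + r = w + (h + r) by rewrite addrA subrK.
move: (h + r) rhP w wX w_orth => z zP w wX w_orth.
have wz := w_orth _ zP; have zw : wform Phi z w = 0 by rewrite wformC.
have -> : wform Phi (w + z) (w + z) = wform Phi w w + wform Phi z z.
  by rewrite wformD !(wformC _ _ (w + z)) !wformD wz zw add0r addr0.
rewrite addr_ge0 //.
  apply: wform_local_ge0 tC _ wX; apply: le_trans leD; rewrite ler_nat.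
  by clear -leS; lia.
apply: (IH P') => // U; rewrite inE => /andP[_]; exact: leP.
Qed.

End Positivity.

(** * From polynomials to functions on points *)

Section Polynomials.

Variables (R : realFieldType) (Omega : finType) (n : nat).
Local Notation k := (indet_count Omega n).
Local Notation point := {ffun 'I_n -> Omega}.
Implicit Types (m : 'X_{1..k}) (p : {mpoly R[k]}).

Lemma card_mnm_vbls m : (#|mnm_vbls m| <= mdeg m)%N.
Proof.
apply: leq_trans (leq_imset_card _ _) _; rewrite mdegE -sum1_card big_mkcond.
by apply: leq_sum => v _; rewrite inE; case: (m v).
Qed.

Lemma meval_mnm_depends m : depends_on (mnm_vbls m)
  (fun x : point => ('X_[m] : {mpoly R[k]}).@[indicator_point R x]).
Proof.
move=> x y xy; rewrite !mevalX; apply: eq_bigr => v _.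
have [->|mv] := eqVneq (m v) 0%N; first by rewrite !expr0.
by rewrite /indicator_point xy //; apply/imsetP; exists v; rewrite ?inE.
Qed.

Lemma msize_sqr_le (d : nat) p : (msize p <= d.+1)%N -> (msize (p ^+ 2) <= (2 * d).+1)%N.
Proof.
rewrite expr2; have [->|p0] := eqVneq p 0; first by rewrite mul0r msize0.
by rewrite msizeM //; move: (msize p) => a; clear; lia.
Qed.

Lemma meval_span_local (d : nat) p : (0 < #|Omega|)%N -> (msize p <= d.+1)%N ->
  [ffun x : point => p.@[indicator_point R x] : R^o] \in
  span_local R Omega [set U : {set 'I_n} | (#|U| <= d)%N].
Proof.
move=> q_gt0 hp.
pose mono m : {ffun point -> R^o} :=
  [ffun x => ('X_[m] : {mpoly R[k]}).@[indicator_point R x]].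
have -> : [ffun x : point => p.@[indicator_point R x] : R^o] =
    \sum_(m <- msupp p) p@_m *: mono m.
  apply/ffunP => x; rewrite ffunE {1}(mpolyE p) raddf_sum sum_ffunE.
  by apply: eq_bigr => m _; rewrite /= mevalZ !ffunE.
rewrite big_seq; apply: memv_suml => m mp; apply: memvZ.
apply: (subvP (sumv_sup (mnm_vbls m) _ (subvv _))).
  rewrite inE; apply: leq_trans (card_mnm_vbls m) _.
  by rewrite -ltnS; apply: leq_trans (msize_mdeg_lt mp) hp.
by apply/(local_onP q_gt0) => x y xy; rewrite !ffunE (meval_mnm_depends xy).
Qed.

End Polynomials.

(** Each monomial has its own planted distribution, but [planted_closureE] integrates all of them
    against the same [pseudo_dens], so the sum over monomials reassembles [p]. *)
Lemma pseudo_expectationE (R : realFieldType) (Omega F : finType) (n tau d : nat)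
    (G : factor_graph R Omega F n) (SMALL zeta : R)
    (p : {mpoly R[indet_count Omega n]}) :
  (0 < #|Omega|)%N -> (forall f, (tau.-1 <= arity G f)%N) ->
  (forall f, wise_uniform tau.-1 (@mu R Omega F n G f)) ->
  (0 < tau)%N -> 0 <= SMALL -> 0 < zeta -> plausibility_assumption G tau SMALL zeta ->
  d%:R <= zeta * SMALL -> (msize p <= d.+1)%N ->
  pseudo_expectation G tau SMALL p =
  (\sum_x p.@[indicator_point R x] * pseudo_dens G tau SMALL x)
    / #|{: {ffun 'I_n -> Omega}}|%:R.
Proof.
move=> q_gt0 arityG uniformG tau_gt0 SMALL_ge0 zeta_gt0 plausG le_d hp.
rewrite /pseudo_expectation big_seq.
transitivity (\sum_(m <- msupp p | m \in msupp p) \sum_x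
    p@_m * ('X_[m] : {mpoly R[_]}).@[indicator_point R x] * pseudo_dens G tau SMALL x
      / #|{: {ffun 'I_n -> Omega}}|%:R).
  apply: eq_bigr => m mp; rewrite /pseudo_expectation_mnm.
  rewrite (planted_closureE q_gt0 arityG uniformG tau_gt0 SMALL_ge0 zeta_gt0 plausG
    (@meval_mnm_depends R Omega n m)).
    by rewrite mulr_suml mulr_sumr; apply: eq_bigr => x _; rewrite !mulrA.
  apply: le_trans le_d; rewrite ler_nat; apply: leq_trans (card_mnm_vbls m) _.
  by rewrite -ltnS; apply: leq_trans (msize_mdeg_lt mp) hp.
rewrite -big_seq exchange_big mulr_suml; apply: eq_bigr => x _ /=.
rewrite [in RHS](mpolyE p) raddf_sum !mulr_suml; apply: eq_bigr => m _.
by rewrite /= mevalZ.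
Qed.

Theorem theorem6p1 (R : realFieldType) (Omega F : finType) (n K tau : nat)
    (G : factor_graph R Omega F n) (SMALL zeta : R) (D : nat)
    (p : {mpoly R[indet_count Omega n]}) :
  (2 <= #|Omega|)%N ->
  (3 <= K)%N ->
  (3 <= tau <= K)%N ->
  (forall f : F, (tau.-1 <= arity G f <= K)%N) ->
  (forall f : F, wise_uniform tau.-1 (@mu R Omega F n G f)) ->
  1 <= SMALL <= n%:R / 2 ->
  0 < zeta < 1 ->
  K%:R <= zeta * SMALL ->
  plausibility_assumption G tau SMALL zeta ->
  (1 <= D)%N ->
  D%:R <= 3^-1 * zeta * SMALL ->
  (msize p <= D.+1)%N ->
  0 <= pseudo_expectation G tau SMALL (p ^+ 2).
Proof.
move=> q_ge2 _ /andP[tau_ge3 _] arityG uniformG /andP[SMALL_ge1 _].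
move=> /andP[zeta_gt0 _] _ plausG _ leD hp.
have q_gt0 : (0 < #|Omega|)%N := ltnW q_ge2.
have tau_gt0 : (0 < tau)%N := ltnW (ltnW tau_ge3).
have SMALL_ge0 : 0 <= SMALL := le_trans ler01 SMALL_ge1.
have {}arityG f : (tau.-1 <= arity G f)%N by have /andP[] := arityG f.
have le3D : (3 * D)%N%:R <= zeta * SMALL.
  by rewrite natrM -ler_pdivlMl ?ltr0n // mulrA.
have le2D : (2 * D)%N%:R <= zeta * SMALL.
  by apply: le_trans le3D; rewrite ler_nat leq_mul2r orbT.
rewrite (pseudo_expectationE q_gt0 arityG uniformG tau_gt0 SMALL_ge0 zeta_gt0 plausG
  le2D (msize_sqr_le hp)).
apply: mulr_ge0; last by rewrite invr_ge0 ler0n.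
(* Evaluation turns [p] into a sum of functions of at most [D] variables each, and the sets of size
   at most [D] are closed under passing to smaller sizes. *)
have := span_local_ge0 q_gt0 arityG uniformG tau_gt0 SMALL_ge0 zeta_gt0 plausG le3D
  _ _ (meval_span_local q_gt0 hp).
rewrite /wform => h; under eq_bigr do rewrite expr2 mevalM.
have /h {}h : forall U : {set 'I_n},
  U \in [set U : {set 'I_n} | (#|U| <= D)%N] -> (#|U| <= D)%N by move=> U; rewrite inE.
apply: le_trans (h _) _; first by move=> U T; rewrite !inE => leT /ltnW/leq_trans->.
by apply: ler_sum => x _; rewrite !ffunE.
Qed.
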